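(* Let $(\mathcal C,\otimes,I)$ be a symmetric monoidal category with finite coproducts, let $\mathsf T=(T,\eta,\mu)$ be a linear exponential monad on it, and let $A$ be a finite set. Suppose that the object of behaviours $\mathsf{Beh}$ and the object of traces $\mathsf{Tr}$ for generative $\mathsf T$-systems with alphabet $A$ exist. Then the reflection map $\mathsf{reflect}\colon\mathsf{Beh}\to\mathsf{Tr}$ and the reification map $\mathsf{reify}\colon\mathsf{Tr}\to\mathsf{Beh}$ satisfy $\mathsf{reflect}\circ\mathsf{reify}=\mathrm{id}_{\mathsf{Tr}}$ in $\mathcal C$.
   Context: A symmetric opmonoidal structure on a monad $\mathsf T=(T,\eta,\mu)$ on a symmetric monoidal category $(\mathcal C,\otimes,I)$ consists of a map $\upsilon_I\colon TI\to I$ and natural maps $\upsilon_{XY}\colon T(X\otimes Y)\to TX\otimes TY$ making $T$ a symmetric opmonoidal (colax monoidal) functor and $\eta,\mu$ opmonoidal transformations. It lifts the symmetric monoidal structure of $\mathcal C$ to the category $\mathcal C^{\mathsf T}$ of Eilenberg--Moore algebras: $(X,x)\otimes(Y,y)=(X\otimes Y,(x\otimes y)\circ\upsilon_{XY})$, with unit $(I,\upsilon_I)$ and constraints those of $\mathcal C$. A linear exponential monad is a symmetric opmonoidal monad for which $(I,\upsilon_I)$ is initial in $\mathcal C^{\mathsf T}$ and, for all algebras $(X,x),(Y,y)$, the cospan $(X,x)\cong(X,x)\otimes(I,\upsilon_I)\xrightarrow{1\otimes !}(X,x)\otimes(Y,y)\xleftarrow{!\otimes 1}(I,\upsilon_I)\otimes(Y,y)\cong(Y,y)$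 is a coproduct in $\mathcal C^{\mathsf T}$, where $!$ denotes the unique maps out of the initial algebra. So finite coproducts in $\mathcal C^{\mathsf T}$ are given by $\otimes$. Write $F^{\mathsf T}X=(TX,\mu_X)$ for free algebras, and $\varphi\colon T(\sum_i A_i)\to\bigotimes_i TA_i$ for the map underlying the canonical isomorphism $F^{\mathsf T}(\sum_i A_i)\cong\bigotimes_i F^{\mathsf T}A_i$ of coproducts in $\mathcal C^{\mathsf T}$. A generative $\mathsf T$-system with alphabet $A$ is an object $S\in\mathcal C$ with a map $\sigma\colon S\to T(\sum_{a\in A}S)$; a homomorphism $(S,\sigma)\to(U,\upsilon)$ is a map $f\colon S\to U$ of $\mathcal C$ with $\upsilon f=T(\sum_a f)\sigma$. The object of behaviours is a final object $(\mathsf{Beh},\beta)$ of the category of generative $\mathsf T$-systems with alphabet $A$; the behaviour map of $(S,\sigma)$ is the unique homomorphism $(S,\sigma)\to(\mathsf{Beh},\beta)$. An $A$-ary comagma in a category with finite coproducts is an object $X$ with a map $X\to\sum_{a\in A}X$; homomorphisms are maps commuting with these. The object of traces is a final object $(\mathsf{Tr},\tau)$ in the category of $A$-ary comagmas in $\mathcal C^{\mathsf T}$. The free $A$-ary comagma in $\mathcal C^{\mathsf T}$ associated to a generative $\mathsf T$-system $(S,\sigma)$ is $(F^{\mathsf T}S,\sigma^\sharp)$, where $\sigma^\sharp$ is the composite $TS\xrightarrow{T\sigma}TT(\sum_aS)\xrightarrow{\mu}T(\sum_aS)\xrightarrow{\varphi}\bigotimes_{a}TS$. The trace map of $(S,\sigma)$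 is $\mathsf{tr}\colon S\xrightarrow{\eta_S}TS\to\mathsf{Tr}$, where the second map underlies the unique comagma homomorphism $(F^{\mathsf T}S,\sigma^\sharp)\to(\mathsf{Tr},\tau)$. The map $\mathsf{reflect}\colon\mathsf{Beh}\to\mathsf{Tr}$ is the trace map of $(\mathsf{Beh},\beta)$. The generative $\mathsf T$-system associated to an $A$-ary comagma $\sigma\colon S\to\bigotimes_{a\in A}S$ in $\mathcal C^{\mathsf T}$ is $(S,\sigma^\flat)$, where $\sigma^\flat$ is the composite $S\xrightarrow{\sigma}\bigotimes_aS\xrightarrow{\bigotimes_a\eta_S}\bigotimes_aTS\xrightarrow{\varphi^{-1}}T(\sum_aS)$. The map $\mathsf{reify}\colon\mathsf{Tr}\to\mathsf{Beh}$ is the behaviour map of $(\mathsf{Tr},\tau^\flat)$. *)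

(* Defs.v *)
(* Arrows are compared by Leibniz equality; proof irrelevance makes arrows that
   bundle a commuting square equal as soon as their underlying arrows are.
   Universal properties are records holding the mediating arrows and their
   uniqueness, so that these arrows can be named without a choice principle. *)
From mathcomp Require Import all_boot.
From Stdlib Require Import ProofIrrelevance.

Set Implicit Arguments.
Unset Strict Implicit.
Unset Printing Implicit Defensive.

Declare Scope cat_scope.
Delimit Scope cat_scope with cat.
Local Open Scope cat_scope.

Record category := Category {
  obj :> Type;
  hom : obj -> obj -> Type;
  idm : forall X, hom X X;
  comp : forall X Y Z, hom Y Z -> hom X Y -> hom X Z;
  comp1m : forall X Y (f : hom X Y), comp (idm Y) f = f;
  compm1 : forall X Y (f : hom X Y), comp f (idm X) = f;
  compmA : forall W X Y Z (h : hom Y Z) (g : hom X Y) (f : hom W X),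
    comp h (comp g f) = comp (comp h g) f
}.
Arguments hom {c} X Y.
Arguments idm {c} X.
Arguments comp {c X Y Z} g f.

Notation "g ∘ f" := (comp g f) (at level 40, left associativity) : cat_scope.

Record iso (C : category) (X Y : C) := Iso {
  fwd : hom X Y;
  bwd : hom Y X;
  bwd_fwd : bwd ∘ fwd = idm X;
  fwd_bwd : fwd ∘ bwd = idm Y
}.

Record is_initial (C : category) (Z : C) := IsInitial {
  from_initial : forall X, hom Z X;
  from_initial_uniq : forall X (f : hom Z X), f = from_initial X
}.

Record is_terminal (C : category) (Z : C) := IsTerminal {
  to_terminal : forall X, hom X Z;
  to_terminal_uniq : forall X (f : hom X Z), f = to_terminal X
}.

Record is_binary_coproduct (C : category) (X Y Z : C)
    (i1 : hom X Z) (i2 : hom Y Z) := IsBinaryCoproduct {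
  copair : forall W, hom X W -> hom Y W -> hom Z W;
  copair_inl : forall W (f : hom X W) (g : hom Y W), copair f g ∘ i1 = f;
  copair_inr : forall W (f : hom X W) (g : hom Y W), copair f g ∘ i2 = g;
  copair_uniq : forall W (f : hom X W) (g : hom Y W) (h : hom Z W),
    h ∘ i1 = f -> h ∘ i2 = g -> h = copair f g
}.

Record coproduct (C : category) (I : Type) (X : I -> C) := Coproduct {
  cop_obj :> C;
  inj : forall i, hom (X i) cop_obj;
  cotuple : forall W, (forall i, hom (X i) W) -> hom cop_obj W;
  cotuple_inj : forall W (f : forall i, hom (X i) W) i, cotuple f ∘ inj i = f i;
  cotuple_uniq : forall W (f : forall i, hom (X i) W) (h : hom cop_obj W),
    (forall i, h ∘ inj i = f i) -> h = cotuple f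
}.

Definition finite_coproducts (C : category) :=
  forall (I : finType) (X : I -> C), coproduct X.

Section Coproducts.
Variables (C : category) (I : Type).

Lemma cotuple_ext (X : I -> C) (K : coproduct X) W (f g : hom K W) :
  (forall i, f ∘ inj K i = g ∘ inj K i) -> f = g.
Proof.
move=> fg; rewrite (cotuple_uniq (h := f) fg).
by symmetry; apply: cotuple_uniq.
Qed.

Definition coproduct_map (X Y : I -> C) (K : coproduct X) (L : coproduct Y)
    (f : forall i, hom (X i) (Y i)) : hom K L :=
  cotuple K (fun i => inj L i ∘ f i).

Lemma coproduct_map1 (X : I -> C) (K : coproduct X) :
  coproduct_map K K (fun i => idm (X i)) = idm K.
Proof.
by apply: cotuple_ext => i; rewrite /coproduct_map cotuple_inj compm1 comp1m.
Qed.

Lemma coproduct_mapM (X Y Z : I -> C) (K : coproduct X) (L : coproduct Y)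
    (M : coproduct Z) (g : forall i, hom (Y i) (Z i))
    (f : forall i, hom (X i) (Y i)) :
  coproduct_map K M (fun i => g i ∘ f i) =
  coproduct_map L M g ∘ coproduct_map K L f.
Proof.
apply: cotuple_ext => i; rewrite /coproduct_map.
by rewrite cotuple_inj -compmA cotuple_inj [RHS]compmA cotuple_inj compmA.
Qed.

Lemma coproduct_isoK (X : I -> C) (K L : coproduct X) :
  cotuple L (inj K) ∘ cotuple K (inj L) = idm K.
Proof.
by apply: cotuple_ext => i; rewrite -compmA !cotuple_inj comp1m.
Qed.

Definition coproduct_iso (X : I -> C) (K L : coproduct X) : iso K L :=
  Iso (coproduct_isoK K L) (coproduct_isoK L K).

End Coproducts.

Record smc := SMC {
  smc_cat :> category;
  tensor : smc_cat -> smc_cat -> smc_cat;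
  tensor_map : forall X X' Y Y' : smc_cat,
    hom X X' -> hom Y Y' -> hom (tensor X Y) (tensor X' Y');
  tensor_map1 : forall X Y, tensor_map (idm X) (idm Y) = idm (tensor X Y);
  tensor_mapM : forall X X' X'' Y Y' Y''
      (g : hom X' X'') (f : hom X X') (k : hom Y' Y'') (h : hom Y Y'),
    tensor_map (g ∘ f) (k ∘ h) = tensor_map g k ∘ tensor_map f h;
  munit : smc_cat;
  assoc : forall X Y Z, iso (tensor (tensor X Y) Z) (tensor X (tensor Y Z));
  lunit : forall X, iso (tensor munit X) X;
  runit : forall X, iso (tensor X munit) X;
  braid : forall X Y, hom (tensor X Y) (tensor Y X);
  assoc_nat : forall X X' Y Y' Z Z' (f : hom X X') (g : hom Y Y') (h : hom Z Z'),
    fwd (assoc X' Y' Z') ∘ tensor_map (tensor_map f g) h =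
    tensor_map f (tensor_map g h) ∘ fwd (assoc X Y Z);
  lunit_nat : forall X X' (f : hom X X'),
    fwd (lunit X') ∘ tensor_map (idm munit) f = f ∘ fwd (lunit X);
  runit_nat : forall X X' (f : hom X X'),
    fwd (runit X') ∘ tensor_map f (idm munit) = f ∘ fwd (runit X);
  braid_nat : forall X X' Y Y' (f : hom X X') (g : hom Y Y'),
    braid X' Y' ∘ tensor_map f g = tensor_map g f ∘ braid X Y;
  triangle : forall X Y,
    tensor_map (idm X) (fwd (lunit Y)) ∘ fwd (assoc X munit Y) =
    tensor_map (fwd (runit X)) (idm Y);
  pentagon : forall W X Y Z,
    fwd (assoc W X (tensor Y Z)) ∘ fwd (assoc (tensor W X) Y Z) =
    tensor_map (idm W) (fwd (assoc X Y Z)) ∘ fwd (assoc W (tensor X Y) Z)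
      ∘ tensor_map (fwd (assoc W X Y)) (idm Z);
  hexagon : forall X Y Z,
    fwd (assoc Y Z X) ∘ braid X (tensor Y Z) ∘ fwd (assoc X Y Z) =
    tensor_map (idm Y) (braid X Z) ∘ fwd (assoc Y X Z)
      ∘ tensor_map (braid X Y) (idm Z);
  braidK : forall X Y, braid Y X ∘ braid X Y = idm (tensor X Y)
}.
Arguments munit {s}.

Notation "X ⊗ Y" := (tensor X Y) (at level 39, left associativity) : cat_scope.
Notation "f ⊗₁ g" := (tensor_map f g) (at level 39, left associativity) : cat_scope.

Fixpoint bigtensor (C : smc) (I : Type) (X : I -> C) (s : seq I) : C :=
  if s is i :: s' then X i ⊗ bigtensor X s' else munit.

Fixpoint bigtensor_map (C : smc) (I : Type) (X Y : I -> C)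
    (f : forall i, hom (X i) (Y i)) (s : seq I) :
    hom (bigtensor X s) (bigtensor Y s) :=
  match s with
  | [::] => idm munit
  | i :: s' => f i ⊗₁ bigtensor_map f s'
  end.

Record functor (C D : category) := Functor {
  fobj :> C -> D;
  fmap : forall X Y, hom X Y -> hom (fobj X) (fobj Y);
  fmap1 : forall X, fmap (idm X) = idm (fobj X);
  fmapM : forall X Y Z (g : hom Y Z) (f : hom X Y),
    fmap (g ∘ f) = fmap g ∘ fmap f
}.

Record monad (C : category) := Monad {
  monad_functor :> functor C C;
  eta : forall X, hom X (monad_functor X);
  mu : forall X, hom (monad_functor (monad_functor X)) (monad_functor X);
  eta_nat : forall X Y (f : hom X Y), eta Y ∘ f = fmap monad_functor f ∘ eta X;
  mu_nat : forall X Y (f : hom X Y),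
    mu Y ∘ fmap monad_functor (fmap monad_functor f) =
    fmap monad_functor f ∘ mu X;
  mu_eta : forall X, mu X ∘ eta (monad_functor X) = idm (monad_functor X);
  mu_fmap_eta : forall X,
    mu X ∘ fmap monad_functor (eta X) = idm (monad_functor X);
  mu_mu : forall X,
    mu X ∘ fmap monad_functor (mu X) = mu X ∘ mu (monad_functor X)
}.

Section Algebras.
Variables (C : category) (T : monad C).

Record algebra_structure (X : C) := AlgebraStructure {
  act : hom (T X) X;
  act_eta : act ∘ eta T X = idm X;
  act_mu : act ∘ mu T X = act ∘ fmap T act
}.

Record algebra := Algebra {
  carrier : C;
  structure : algebra_structure carrier
}.

Record algebra_hom (X Y : algebra) := AlgebraHom {
  underlying : hom (carrier X) (carrier Y);
  underlyingP :
    underlying ∘ act (structure X) = act (structure Y) ∘ fmap T underlying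
}.

Lemma algebra_hom_eq (X Y : algebra) (f g : algebra_hom X Y) :
  underlying f = underlying g -> f = g.
Proof.
case: f g => [f Pf] [g Pg] /= fg; subst g; congr AlgebraHom.
exact: proof_irrelevance.
Qed.

Lemma algebra_idP (X : algebra) :
  idm (carrier X) ∘ act (structure X) =
  act (structure X) ∘ fmap T (idm (carrier X)).
Proof. by rewrite fmap1 comp1m compm1. Qed.

Lemma algebra_compP (X Y Z : algebra) (g : algebra_hom Y Z)
    (f : algebra_hom X Y) :
  underlying g ∘ underlying f ∘ act (structure X) =
  act (structure Z) ∘ fmap T (underlying g ∘ underlying f).
Proof. by rewrite -compmA underlyingP compmA underlyingP -compmA fmapM. Qed.

Definition EM : category.
refine (@Category algebra algebra_hom
  (fun X => AlgebraHom (algebra_idP X))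
  (fun X Y Z g f => AlgebraHom (algebra_compP g f)) _ _ _).
- by move=> X Y f; apply: algebra_hom_eq; rewrite /= comp1m.
- by move=> X Y f; apply: algebra_hom_eq; rewrite /= compm1.
- by move=> W X Y Z h g f; apply: algebra_hom_eq; rewrite /= compmA.
Defined.

Definition free (X : C) : EM :=
  Algebra (AlgebraStructure (mu_eta T X) (esym (mu_mu T X))).

Definition free_map (X Y : C) (f : hom X Y) : hom (free X) (free Y) :=
  @AlgebraHom (free X) (free Y) (fmap T f) (esym (mu_nat T f)).

Definition free_mult (X : C) : hom (free (T X)) (free X) :=
  @AlgebraHom (free (T X)) (free X) (mu T X) (esym (mu_mu T X)).

Lemma free_extP (X : C) (Y : EM) (f : hom X (carrier Y)) :
  act (structure Y) ∘ fmap T f ∘ mu T X =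
  act (structure Y) ∘ fmap T (act (structure Y) ∘ fmap T f).
Proof. by rewrite -compmA -mu_nat compmA act_mu fmapM !compmA. Qed.

Definition free_ext (X : C) (Y : EM) (f : hom X (carrier Y)) : hom (free X) Y :=
  @AlgebraHom (free X) Y _ (free_extP f).

Lemma free_ext_eta (X : C) (Y : EM) (f : hom X (carrier Y)) :
  underlying (free_ext f) ∘ eta T X = f.
Proof. by rewrite /= -compmA -eta_nat compmA act_eta comp1m. Qed.

Lemma free_ext_uniq (X : C) (Y : EM) (f : hom X (carrier Y))
    (h : hom (free X) Y) : underlying h ∘ eta T X = f -> h = free_ext f.
Proof.
move=> <-; apply: algebra_hom_eq => /=.
rewrite fmapM compmA -(underlyingP h) /= -compmA mu_fmap_eta.
by rewrite compm1.
Qed.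

(** Being a left adjoint, [free] preserves coproducts. *)
Definition free_coproduct (I : Type) (X : I -> C) (K : coproduct X) :
  coproduct (fun i => free (X i)).
refine (@Coproduct EM I (fun i => free (X i)) (free K)
  (fun i => free_map (inj K i))
  (fun W f => free_ext (cotuple K (fun i => underlying (f i) ∘ eta T (X i))))
  _ _).
- move=> W f i; apply: algebra_hom_eq => /=.
  rewrite -compmA -fmapM cotuple_inj.
  by rewrite [RHS](congr1 (@underlying _ _) (free_ext_uniq (h := f i) erefl)).
- move=> W f h hf; apply: free_ext_uniq; apply: cotuple_uniq => i.
  by rewrite -hf /= -!compmA eta_nat.
Defined.

End Algebras.

Arguments act {C T X} a.

Section Opmonoidal.
Variables (C : smc) (T : monad C).

(** The last four laws say that [eta : 1 -> T] and [mu : TT -> T] are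
    opmonoidal, the structure maps of [TT] being those of [T] composed. *)
Record symmetric_opmonoidal := SymmetricOpmonoidal {
  opI : hom (T munit) munit;
  opM : forall X Y, hom (T (X ⊗ Y)) (T X ⊗ T Y);
  opM_nat : forall X X' Y Y' (f : hom X X') (g : hom Y Y'),
    opM X' Y' ∘ fmap T (f ⊗₁ g) = (fmap T f ⊗₁ fmap T g) ∘ opM X Y;
  opM_assoc : forall X Y Z,
    fwd (assoc (T X) (T Y) (T Z)) ∘ (opM X Y ⊗₁ idm (T Z)) ∘ opM (X ⊗ Y) Z =
    (idm (T X) ⊗₁ opM Y Z) ∘ opM X (Y ⊗ Z) ∘ fmap T (fwd (assoc X Y Z));
  opM_lunit : forall X,
    fwd (lunit (T X)) ∘ (opI ⊗₁ idm (T X)) ∘ opM munit X =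
    fmap T (fwd (lunit X));
  opM_runit : forall X,
    fwd (runit (T X)) ∘ (idm (T X) ⊗₁ opI) ∘ opM X munit =
    fmap T (fwd (runit X));
  opM_braid : forall X Y,
    braid (T X) (T Y) ∘ opM X Y = opM Y X ∘ fmap T (braid X Y);
  opI_eta : opI ∘ eta T munit = idm munit;
  opM_eta : forall X Y, opM X Y ∘ eta T (X ⊗ Y) = eta T X ⊗₁ eta T Y;
  opI_mu : opI ∘ mu T munit = opI ∘ fmap T opI;
  opM_mu : forall X Y,
    opM X Y ∘ mu T (X ⊗ Y) =
    (mu T X ⊗₁ mu T Y) ∘ opM (T X) (T Y) ∘ fmap T (opM X Y)
}.

Variable u : symmetric_opmonoidal.

Definition unit_structure : algebra_structure T munit :=
  AlgebraStructure (opI_eta u) (opI_mu u).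

Definition tensor_structure (X Y : C) (x : algebra_structure T X)
  (y : algebra_structure T Y) : algebra_structure T (X ⊗ Y).
refine (@AlgebraStructure C T (X ⊗ Y) ((act x ⊗₁ act y) ∘ opM u X Y) _ _).
- by rewrite -compmA opM_eta -tensor_mapM !act_eta tensor_map1.
- rewrite -compmA opM_mu 2!compmA -tensor_mapM !act_mu tensor_mapM.
  by rewrite fmapM -!compmA [in RHS](compmA (opM u X Y)) opM_nat !compmA.
Defined.

Definition EM_unit : EM T := Algebra unit_structure.

Definition EM_tensor (X Y : EM T) : EM T :=
  Algebra (tensor_structure (structure X) (structure Y)).

Lemma EM_tensor_mapP (X X' Y Y' : EM T) (f : hom X X') (g : hom Y Y') :
  (underlying f ⊗₁ underlying g) ∘ act (structure (EM_tensor X Y)) =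
  act (structure (EM_tensor X' Y')) ∘ fmap T (underlying f ⊗₁ underlying g).
Proof.
rewrite /= compmA -tensor_mapM !underlyingP tensor_mapM.
by rewrite -!compmA opM_nat.
Qed.

Definition EM_tensor_map (X X' Y Y' : EM T) (f : hom X X') (g : hom Y Y') :
    hom (EM_tensor X Y) (EM_tensor X' Y') :=
  @AlgebraHom C T (EM_tensor X Y) (EM_tensor X' Y') _ (EM_tensor_mapP f g).

Lemma EM_isoP (X Y : EM T) (e : iso (carrier X) (carrier Y)) :
  fwd e ∘ act (structure X) = act (structure Y) ∘ fmap T (fwd e) ->
  bwd e ∘ act (structure Y) = act (structure X) ∘ fmap T (bwd e).
Proof.
move=> eP; rewrite -[LHS]compm1 -fmap1 -(fwd_bwd e) fmapM.
rewrite [LHS]compmA -[X in X ∘ _](compmA (bwd e)) -eP.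
by rewrite [X in X ∘ _](compmA (bwd e)) bwd_fwd comp1m.
Qed.

Lemma EM_lunitP (X : EM T) :
  fwd (lunit (carrier X)) ∘ act (structure (EM_tensor EM_unit X)) =
  act (structure X) ∘ fmap T (fwd (lunit (carrier X))).
Proof.
rewrite /= -(opM_lunit u) !compmA -lunit_nat -(compmA _ (idm _ ⊗₁ _)).
by rewrite -tensor_mapM comp1m compm1.
Qed.

Lemma EM_runitP (X : EM T) :
  fwd (runit (carrier X)) ∘ act (structure (EM_tensor X EM_unit)) =
  act (structure X) ∘ fmap T (fwd (runit (carrier X))).
Proof.
rewrite /= -(opM_runit u) !compmA -runit_nat -(compmA _ (_ ⊗₁ idm _)).
by rewrite -tensor_mapM comp1m compm1.
Qed.

Definition EM_lunit_inv (X : EM T) : hom X (EM_tensor EM_unit X) :=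
  @AlgebraHom C T X (EM_tensor EM_unit X) _
    (@EM_isoP (EM_tensor EM_unit X) X (lunit (carrier X)) (EM_lunitP X)).

Definition EM_runit_inv (X : EM T) : hom X (EM_tensor X EM_unit) :=
  @AlgebraHom C T X (EM_tensor X EM_unit) _
    (@EM_isoP (EM_tensor X EM_unit) X (runit (carrier X)) (EM_runitP X)).

Definition EM_inl (i : is_initial EM_unit) (X Y : EM T) :
    hom X (EM_tensor X Y) :=
  EM_tensor_map (idm X) (from_initial i Y) ∘ EM_runit_inv X.

Definition EM_inr (i : is_initial EM_unit) (X Y : EM T) :
    hom Y (EM_tensor X Y) :=
  EM_tensor_map (from_initial i X) (idm Y) ∘ EM_lunit_inv Y.

End Opmonoidal.

Record linear_exponential_monad (C : smc) := LinearExponentialMonad {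
  lem_monad :> monad C;
  lem_op : symmetric_opmonoidal lem_monad;
  lem_initial : is_initial (EM_unit lem_op);
  lem_coproduct : forall X Y : EM lem_monad,
    is_binary_coproduct (EM_inl lem_initial X Y) (EM_inr lem_initial X Y)
}.

(** Finite coproducts of algebras are given by iterated tensor product.  The
    algebra structure is built over [bigtensor (carrier \o X) s], so that the
    carrier of the coproduct is by definition a tensor product in [C]. *)
Section FiniteCoproducts.
Variables (C : smc) (T : linear_exponential_monad C).
Variables (I : finType) (X : I -> EM T).

Let u := lem_op T.
Let ini := lem_initial T.
Let cop := @lem_coproduct C T.

Fixpoint bigtensor_structure (s : seq I) :
    algebra_structure T (bigtensor (fun i => carrier (X i)) s) :=
  match s with
  | [::] => unit_structure u
  | i :: s' => tensor_structure u (structure (X i)) (bigtensor_structure s')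
  end.

Definition EM_bigtensor (s : seq I) : EM T := Algebra (bigtensor_structure s).

Lemma mem_tail (i j : I) (s : seq I) : i <> j -> i \in j :: s -> i \in s.
Proof. by move=> /eqP/negPf ij; rewrite inE ij. Qed.

Fixpoint EM_inj (s : seq I) (i : I) : i \in s -> hom (X i) (EM_bigtensor s) :=
  match s with
  | [::] => fun m => False_rect _ (notF m)
  | j :: s' => fun m =>
      match @eqP I i j with
      | ReflectT e => eq_rect_r (fun k => hom (X k) (EM_bigtensor (j :: s')))
                        (EM_inl ini (X j) (EM_bigtensor s')) e
      | ReflectF ne => EM_inr ini (X j) (EM_bigtensor s')
                        ∘ @EM_inj s' i (mem_tail ne m)
      end
  end.

Fixpoint EM_cotuple (s : seq I) (W : EM T) (f : forall i, hom (X i) W) :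
    hom (EM_bigtensor s) W :=
  match s with
  | [::] => from_initial ini W
  | i :: s' => copair (cop (X i) (EM_bigtensor s')) (f i) (EM_cotuple s' f)
  end.

Lemma EM_cotuple_inj (s : seq I) W (f : forall i, hom (X i) W) i
    (m : i \in s) : EM_cotuple s f ∘ EM_inj m = f i.
Proof.
elim: s m => [//|j s IH] m.
cbn [EM_inj EM_cotuple].
case: (@eqP I i j) => [e|ne].
  by subst j; exact: (copair_inl (cop (X i) (EM_bigtensor s))).
by rewrite compmA (copair_inr (cop (X j) (EM_bigtensor s))) IH.
Qed.

Lemma EM_cotuple_uniq (s : seq I) W (f : forall i, hom (X i) W)
    (h : hom (EM_bigtensor s) W) :
  uniq s -> (forall i (m : i \in s), h ∘ EM_inj m = f i) -> h = EM_cotuple s f.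
Proof.
elim: s h => [|j s IH] h; first by move=> _ _; exact: from_initial_uniq.
rewrite cons_uniq => /andP[js us] hf.
apply: (copair_uniq (cop (X j) (EM_bigtensor s))).
  rewrite -(hf j (mem_head j s)); cbn [EM_inj].
  by case: (@eqP I j j) => [e|//]; rewrite (eq_irrelevance e erefl).
apply: IH => // i m.
have m' : i \in j :: s by rewrite inE m orbT.
rewrite -(hf i m'); cbn [EM_inj].
case: (@eqP I i j) => [e|ne]; first by case/negP: js; rewrite -e.
by rewrite (bool_irrelevance (mem_tail ne m') m) [RHS]compmA.
Qed.

Definition EM_coproduct : coproduct X :=
  @Coproduct (EM T) I X (EM_bigtensor (enum I))
    (fun i => EM_inj (mem_enum I i))
    (fun W f => EM_cotuple (enum I) f)
    (fun W f i => EM_cotuple_inj f (mem_enum I i))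
    (fun W f h hf => EM_cotuple_uniq (enum_uniq I)
       (fun i m => etrans
          (congr1 (fun m' => h ∘ EM_inj m') (bool_irrelevance m (mem_enum I i)))
          (hf i))).

End FiniteCoproducts.

Definition EM_finite_coproducts (C : smc) (T : linear_exponential_monad C) :
  finite_coproducts (EM T) := fun I X => EM_coproduct X.
Arguments EM_finite_coproducts {C} T [I] X.

Section Comagmas.
Variables (D : category) (cop : finite_coproducts D) (A : finType).

Record comagma := Comagma {
  cm_obj : D;
  cm_map : hom cm_obj (cop (fun _ : A => cm_obj))
}.

Record comagma_hom (X Y : comagma) := ComagmaHom {
  cm_fun : hom (cm_obj X) (cm_obj Y);
  cm_funP : cm_map Y ∘ cm_fun = coproduct_map _ _ (fun _ => cm_fun) ∘ cm_map X
}.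

Lemma comagma_hom_eq (X Y : comagma) (f g : comagma_hom X Y) :
  cm_fun f = cm_fun g -> f = g.
Proof.
case: f g => [f Pf] [g Pg] /= fg; subst g; congr ComagmaHom.
exact: proof_irrelevance.
Qed.

Lemma comagma_idP (X : comagma) :
  cm_map X ∘ idm (cm_obj X) =
  coproduct_map _ _ (fun _ => idm (cm_obj X)) ∘ cm_map X.
Proof. by rewrite coproduct_map1 comp1m compm1. Qed.

Lemma comagma_compP (X Y Z : comagma) (g : comagma_hom Y Z)
    (f : comagma_hom X Y) :
  cm_map Z ∘ (cm_fun g ∘ cm_fun f) =
  coproduct_map _ _ (fun _ => cm_fun g ∘ cm_fun f) ∘ cm_map X.
Proof.
rewrite (coproduct_mapM _ (cop (fun _ => cm_obj Y))) -compmA -(cm_funP f).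
by rewrite compmA cm_funP compmA.
Qed.

Definition comagmas : category.
refine (@Category comagma comagma_hom
  (fun X => ComagmaHom (comagma_idP X))
  (fun X Y Z g f => ComagmaHom (comagma_compP g f)) _ _ _).
- by move=> X Y f; apply: comagma_hom_eq; rewrite /= comp1m.
- by move=> X Y f; apply: comagma_hom_eq; rewrite /= compm1.
- by move=> W X Y Z h g f; apply: comagma_hom_eq; rewrite /= compmA.
Defined.

End Comagmas.

Section GenerativeSystems.
Variables (C : category) (cop : finite_coproducts C) (T : monad C) (A : finType).

Record gsystem := GSystem {
  gs_obj : C;
  gs_map : hom gs_obj (T (cop (fun _ : A => gs_obj)))
}.

Record gsystem_hom (S U : gsystem) := GSystemHom {
  gs_fun : hom (gs_obj S) (gs_obj U);
  gs_funP : gs_map U ∘ gs_fun =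
            fmap T (coproduct_map _ _ (fun _ => gs_fun)) ∘ gs_map S
}.

Lemma gsystem_hom_eq (S U : gsystem) (f g : gsystem_hom S U) :
  gs_fun f = gs_fun g -> f = g.
Proof.
case: f g => [f Pf] [g Pg] /= fg; subst g; congr GSystemHom.
exact: proof_irrelevance.
Qed.

Lemma gsystem_idP (S : gsystem) :
  gs_map S ∘ idm (gs_obj S) =
  fmap T (coproduct_map _ _ (fun _ => idm (gs_obj S))) ∘ gs_map S.
Proof. by rewrite coproduct_map1 fmap1 comp1m compm1. Qed.

Lemma gsystem_compP (S U V : gsystem) (g : gsystem_hom U V)
    (f : gsystem_hom S U) :
  gs_map V ∘ (gs_fun g ∘ gs_fun f) =
  fmap T (coproduct_map _ _ (fun _ => gs_fun g ∘ gs_fun f)) ∘ gs_map S.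
Proof.
rewrite (coproduct_mapM _ (cop (fun _ => gs_obj U))) fmapM -compmA -(gs_funP f).
by rewrite compmA gs_funP compmA.
Qed.

Definition gsystems : category.
refine (@Category gsystem gsystem_hom
  (fun S => GSystemHom (gsystem_idP S))
  (fun S U V g f => GSystemHom (gsystem_compP g f)) _ _ _).
- by move=> S U f; apply: gsystem_hom_eq; rewrite /= comp1m.
- by move=> S U f; apply: gsystem_hom_eq; rewrite /= compm1.
- by move=> S U V W h g f; apply: gsystem_hom_eq; rewrite /= compmA.
Defined.

Definition behaviour_map (Beh : gsystems) (hBeh : is_terminal Beh)
    (S : gsystems) : hom (gs_obj S) (gs_obj Beh) :=
  gs_fun (to_terminal hBeh S).

End GenerativeSystems.

Section Traces.
Variables (C : smc) (cop : finite_coproducts C).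
Variables (T : linear_exponential_monad C) (A : finType).

Notation Gsys := (gsystems cop T A).
Notation Comag := (comagmas (EM_finite_coproducts T) A).

(** The canonical isomorphism between two coproducts, in algebras, of the family
    [free T \o X]: the image under [free] of [cop X], and the tensor product. *)
Definition phi (X : A -> C) :
    iso (free T (cop X)) (EM_finite_coproducts T (fun a => free T (X a))) :=
  coproduct_iso (free_coproduct T (cop X))
    (EM_finite_coproducts T (fun a => free T (X a))).

Definition free_comagma (S : Gsys) : Comag :=
  @Comagma (EM T) (EM_finite_coproducts T) A (free T (gs_obj S))
    (fwd (phi (fun _ => gs_obj S)) ∘ free_mult T (cop (fun _ => gs_obj S))
       ∘ free_map T (gs_map S)).

Definition trace_map (Tr : Comag) (hTr : is_terminal Tr) (S : Gsys) :
    hom (gs_obj S) (carrier (cm_obj Tr)) :=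
  underlying (cm_fun (to_terminal hTr (free_comagma S))) ∘ eta T (gs_obj S).

Definition system_of_comagma (X : Comag) : Gsys :=
  @GSystem C cop T A (carrier (cm_obj X))
    (underlying (bwd (phi (fun _ => carrier (cm_obj X))))
       ∘ bigtensor_map (fun _ : A => eta T (carrier (cm_obj X))) (enum A)
       ∘ underlying (cm_map X)).

Definition reflect_map (Beh : Gsys) (Tr : Comag) (hTr : is_terminal Tr) :
    hom (gs_obj Beh) (carrier (cm_obj Tr)) :=
  trace_map hTr Beh.

Definition reify_map (Beh : Gsys) (hBeh : is_terminal Beh) (Tr : Comag) :
    hom (carrier (cm_obj Tr)) (gs_obj Beh) :=
  behaviour_map hBeh (system_of_comagma Tr).

End Traces.

(* Main.v *)
(* Trace maps are natural in the system, so reflect ∘ reify is the trace map of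
   the system associated to Tr.  For any comagma X of algebras, the action
   TX -> X is a comagma homomorphism to X from the free comagma on the system
   associated to X; for X = Tr it is therefore the map to the final comagma, and
   the trace map is this action after the unit, which is the identity. *)
Require Import Defs.
From mathcomp Require Import all_boot.

Set Implicit Arguments.
Unset Strict Implicit.

Local Open Scope cat_scope.

Lemma iso_bwd_nat (C : category) (X X' Y Y' : C) (e : iso X Y) (e' : iso X' Y')
    (f : hom X X') (g : hom Y Y') :
  fwd e' ∘ f = g ∘ fwd e -> bwd e' ∘ g = f ∘ bwd e.
Proof.
move=> fg; rewrite -[LHS]compm1 -(fwd_bwd e) compmA -(compmA _ g) -fg.
by rewrite compmA bwd_fwd comp1m.
Qed.

Lemma coproduct_map_inj (C : category) (I : Type) (X Y : I -> C)
    (K : coproduct X) (L : coproduct Y) (f : forall i, hom (X i) (Y i)) i :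
  coproduct_map K L f ∘ inj K i = inj L i ∘ f i.
Proof. exact: cotuple_inj. Qed.

Section Tensors.
Variables (C : smc) (T : linear_exponential_monad C).

Notation u := (lem_op T).
Notation ini := (lem_initial T).

(** By initiality [g] absorbs into the map out of the unit algebra; the rest is naturality of the
    inverse right unitor. *)
Lemma EM_inl_nat (X X' Y Y' : EM T) (f : hom X X') (g : hom Y Y') :
  EM_tensor_map u f g ∘ EM_inl ini X Y = EM_inl ini X' Y' ∘ f.
Proof.
have gini : underlying g ∘ underlying (from_initial ini Y) =
    underlying (from_initial ini Y').
  by rewrite -(from_initial_uniq ini (g ∘ from_initial ini Y)).
apply: algebra_hom_eq.
rewrite /= -compmA (iso_bwd_nat (runit_nat (underlying f))).
by rewrite !compmA -!tensor_mapM gini compm1 comp1m compm1.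
Qed.

Lemma EM_inr_nat (X X' Y Y' : EM T) (f : hom X X') (g : hom Y Y') :
  EM_tensor_map u f g ∘ EM_inr ini X Y = EM_inr ini X' Y' ∘ g.
Proof.
have fini : underlying f ∘ underlying (from_initial ini X) =
    underlying (from_initial ini X').
  by rewrite -(from_initial_uniq ini (f ∘ from_initial ini X)).
apply: algebra_hom_eq.
rewrite /= -compmA (iso_bwd_nat (lunit_nat (underlying g))).
by rewrite !compmA -!tensor_mapM fini compm1 comp1m compm1.
Qed.

Variables (I : finType) (X Y : I -> EM T) (f : forall i, hom (X i) (Y i)).

(** Lifts [bigtensor_map] to algebras, where the universal property of coproducts can be applied to
    it. *)
Fixpoint EM_bigtensor_map (s : seq I) :
    hom (EM_bigtensor (T := T) X s) (EM_bigtensor (T := T) Y s) :=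
  match s with
  | [::] => idm (EM_unit u : EM T)
  | i :: s' => EM_tensor_map u (f i) (EM_bigtensor_map s')
  end.

Lemma underlying_EM_bigtensor_map (s : seq I) :
  underlying (EM_bigtensor_map s) = bigtensor_map (fun i => underlying (f i)) s.
Proof. by elim: s => //= i s ->. Qed.

Lemma EM_bigtensor_map_inj (s : seq I) i (m : i \in s) :
  EM_bigtensor_map s ∘ EM_inj X m = EM_inj Y m ∘ f i.
Proof.
elim: s m => [//|j s IH] m; cbn [EM_inj EM_bigtensor_map].
(* [EM_inj] branches on this test; in the head case, substituting along [e] lets its transport
   compute away. *)
case: (@eqP I i j) => [e|ne].
  by subst j; exact: (EM_inl_nat (f i) (EM_bigtensor_map s)).
by rewrite [LHS]compmA (EM_inr_nat (f j) (EM_bigtensor_map s)) -compmA IH compmA.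
Qed.

(** The tensor of the [f i] commutes with the injections, so it is the mediating arrow. This lets
    coproduct maps of algebras be composed in [C] with tensors of units [eta], which need not be
    algebra maps. *)
Lemma underlying_EM_coproduct_map :
  underlying (coproduct_map (EM_finite_coproducts T X)
                            (EM_finite_coproducts T Y) f) =
  bigtensor_map (fun i => underlying (f i)) (enum I).
Proof.
rewrite -underlying_EM_bigtensor_map; congr underlying; symmetry.
apply: (cotuple_uniq (c := EM_finite_coproducts T X)) => i.
exact: EM_bigtensor_map_inj.
Qed.

End Tensors.

Lemma bigtensor_mapK (C : smc) (I : Type) (X Y : I -> C)
    (g : forall i, hom (Y i) (X i)) (f : forall i, hom (X i) (Y i)) s :
  (forall i, g i ∘ f i = idm (X i)) ->
  bigtensor_map g s ∘ bigtensor_map f s = idm (bigtensor X s).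
Proof.
move=> gf; elim: s => [|i s IH] /=; first by rewrite comp1m.
by rewrite -tensor_mapM gf IH tensor_map1.
Qed.

Section ActionComagma.
Variables (C : smc) (cop : finite_coproducts C).
Variables (T : linear_exponential_monad C) (A : finType).

Notation Gsys := (gsystems cop T A).
Notation Comag := (comagmas (EM_finite_coproducts T) A).

Lemma phi_inj (X : A -> C) a :
  fwd (phi cop T X) ∘ free_map T (inj (cop X) a) =
  inj (EM_finite_coproducts T (fun a => free T (X a))) a.
Proof. exact: (cotuple_inj (free_coproduct T (cop X))). Qed.

(** Both sides are algebra maps out of a coproduct of free algebras, so it suffices to compare them
    on the injections. *)
Lemma phi_nat (X Y : A -> C) (f : forall a, hom (X a) (Y a)) :
  fwd (phi cop T Y) ∘ free_map T (coproduct_map (cop X) (cop Y) f) =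
  coproduct_map _ _ (fun a => free_map T (f a)) ∘ fwd (phi cop T X).
Proof.
apply: (cotuple_ext (K := free_coproduct T (cop X))) => a.
rewrite -[RHS]compmA (phi_inj X a).
rewrite (coproduct_map_inj (X := fun a => free T (X a))) -phi_inj -!compmA.
congr (_ ∘ _); apply: algebra_hom_eq.
by rewrite /= -!fmapM coproduct_map_inj.
Qed.

(** Makes the free comagma functorial in the system: naturality of [phi] and [mu] reduces the square
    to the one defining [f]. *)
Lemma free_comagma_mapP (S U : Gsys) (f : hom S U) :
  cm_map (free_comagma U) ∘ free_map T (gs_fun f) =
  coproduct_map _ _ (fun _ => free_map T (gs_fun f)) ∘ cm_map (free_comagma S).
Proof.
cbn [cm_map free_comagma].
rewrite !compmA -phi_nat -!compmA; congr (_ ∘ _).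
apply: algebra_hom_eq; rewrite /= -fmapM gs_funP fmapM !compmA.
by rewrite mu_nat.
Qed.

Definition free_comagma_map (S U : Gsys) (f : hom S U) :
    hom (free_comagma S) (free_comagma U) :=
  @ComagmaHom (EM T) (EM_finite_coproducts T) A
    (free_comagma S) (free_comagma U) _ (free_comagma_mapP f).

(** By finality, the map from the free comagma on [U] precomposed with [free_comagma_map f] is the
    one from that on [S]; naturality of [eta] does the rest. *)
Lemma trace_map_nat (Tr : Comag) (hTr : is_terminal Tr) (S U : Gsys)
    (f : hom S U) :
  trace_map hTr U ∘ gs_fun f = trace_map hTr S.
Proof.
rewrite /trace_map.
rewrite -(to_terminal_uniq hTr (to_terminal hTr _ ∘ free_comagma_map f)) /=.
by rewrite -!compmA eta_nat.
Qed.

(** As [phi] is an isomorphism of algebras, transporting the free action [mu] along it gives the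
    action on the tensor product. *)
Lemma fwd_phi_mu (X : A -> C) :
  underlying (fwd (phi cop T X)) ∘ mu T (cop X) ∘
    fmap T (underlying (bwd (phi cop T X))) =
  act (structure (EM_finite_coproducts T (fun a => free T (X a)) : EM T)).
Proof.
have := underlyingP (fwd (phi cop T X)); rewrite [act (structure _)]/= => ->.
rewrite -compmA -fmapM.
have := congr1 (@underlying _ _ _ _) (fwd_bwd (phi cop T X)).
by move=> /= ->; rewrite fmap1 compm1.
Qed.

Definition counit (X : EM T) : hom (free T (carrier X)) X :=
  @AlgebraHom C T (free T (carrier X)) X (act (structure X))
    (act_mu (structure X)).

(** The tensor of actions moves past [mu] and under [T], where it cancels the units inserted by
    [system_of_comagma]. What remains is that [cm_map X] is an algebra map. *)
Lemma counit_comagmaP (X : Comag) :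
  cm_map X ∘ counit (cm_obj X) =
  coproduct_map _ _ (fun _ => counit (cm_obj X)) ∘
    cm_map (free_comagma (system_of_comagma cop X)).
Proof.
apply: algebra_hom_eq.
cbn [underlying Defs.comp EM cm_map free_comagma].
rewrite underlying_EM_coproduct_map.
set B := bigtensor_map _ _.
set p := underlying (fwd (phi cop T (fun _ : A => carrier (cm_obj X)))).
set b := underlying (bwd (phi cop T (fun _ : A => carrier (cm_obj X)))).
pose n := bigtensor_map (fun _ : A => eta T (carrier (cm_obj X))) (enum A).
have BK : B ∘ n = idm _ by apply: bigtensor_mapK => _; exact: act_eta.
(* [B] underlies an algebra map, and [fwd_phi_mu] rewrites the action on its source. *)
have BP : B ∘ (p ∘ mu T _ ∘ fmap T b) =
    act (structure (EM_finite_coproducts T (fun _ : A => cm_obj X) : EM T)) ∘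
    fmap T B.
  have := underlyingP (coproduct_map
    (EM_finite_coproducts T (fun _ : A => free T (carrier (cm_obj X))))
    (EM_finite_coproducts T (fun _ : A => cm_obj X))
    (fun _ => counit (cm_obj X))).
  by rewrite underlying_EM_coproduct_map -fwd_phi_mu.
(* Unfolds the free comagma on the associated system, whose structure map is [b ∘ n] after that of
   [X]. *)
change (underlying (cm_map X) ∘ act (structure (cm_obj X)) =
  B ∘ (p ∘ mu T _ ∘ fmap T (b ∘ n ∘ underlying (cm_map X)))).
rewrite -(compmA b) fmapM (compmA (p ∘ _)) compmA BP -compmA -fmapM.
by rewrite (compmA B) BK comp1m underlyingP.
Qed.

Definition counit_comagma (X : Comag) :
    hom (free_comagma (system_of_comagma cop X)) X :=
  @ComagmaHom (EM T) (EM_finite_coproducts T) A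
    (free_comagma (system_of_comagma cop X)) X _ (counit_comagmaP X).

Lemma trace_map_system_of_comagma (Tr : Comag) (hTr : is_terminal Tr) :
  trace_map hTr (system_of_comagma cop Tr) = idm (carrier (cm_obj Tr)).
Proof.
rewrite /trace_map -(to_terminal_uniq hTr (counit_comagma Tr)).
exact: act_eta.
Qed.

End ActionComagma.

Theorem proposition78 (C : smc) (cop : finite_coproducts C)
  (T : linear_exponential_monad C) (A : finType)
  (Beh : gsystems cop T A) (hBeh : is_terminal Beh)
  (Tr : comagmas (EM_finite_coproducts T) A) (hTr : is_terminal Tr) :
  reflect_map Beh hTr ∘ reify_map hBeh Tr = idm (carrier (cm_obj Tr)).
Proof.
exact: etrans (trace_map_nat _ (to_terminal hBeh _))
              (trace_map_system_of_comagma _ _).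
Qed.
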